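(* There is an $\omega$-model of $\mathsf{RCA}_0$ and $\mathsf{AP}$ that is not a model of $\mathsf{ACA}$ (arithmetical comprehension), where $\mathsf{AP}$ is the principle that every topological dynamical system $(C,f)$ on $2^\omega$ contains an almost periodic point.
   Context: An $\omega$-model is a model of second order arithmetic whose first order part is the standard natural numbers. $\mathsf{AP}$ is formulated in second order arithmetic as follows. $2^{<\omega}$ is the set of finite binary strings, $\lambda$ the empty string, $|\sigma|$ the length of $\sigma$, $\preceq$ the initial segment relation (also between a string and an infinite sequence), and $X\upharpoonright_n$ the initial segment of $X$ of length $n$. A tree is a subset of $2^{<\omega}$ closed under initial segments; $[C]$ denotes the collection of infinite paths through a tree $C$. A function $f:2^{<\omega}\to 2^{<\omega}$ encodes a continuous transformation of $2^\omega$ if (1) $f$ is total; (2) $f$ is order preserving, i.e. $\sigma\preceq\tau$ implies $f(\sigma)\preceq f(\tau)$; (3) $(\forall l)(\exists m)(\forall\sigma\in\{0,1\}^m)\,|f(\sigma)|\ge l$. By convention such an $f$ is also assumed to satisfy $|f(\sigma)|<|\sigma|$ for all $\sigma\ne\lambda$. The transformation encoded is $F(X)=\lim_l f(X\upharpoonright_l)$. Put $f^0(\sigma)=\sigma$, $f^k(\sigma)=f(f^{k-1}(\sigma))$ for $k>0$, and $F^k(X)=\lim_l f^k(X\upharpoonright_l)$. A pair $(C,f)$ is a (topological dynamical) system on $2^\omega$ if (i) $C$ is a tree; (ii) $f$ encodes a continuous transformation of $2^\omega$; (iii) $[C]\neq\emptyset$; (iv) for all $\sigma\in C$, $f(\sigma)\in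 C$. $X$ is an almost periodic point of $(C,f)$ if $X\in[C]$ and $(\forall c)(\exists b)(\forall n)(\exists k<b)\,(F^{n+k}(X)\succeq X\upharpoonright_c)$. *)

(* Defs.v *)
From mathcomp Require Import all_boot.
From mathcomp Require Import boolp.

Set Implicit Arguments.
Unset Strict Implicit.
Unset Printing Implicit Defensive.

(* Number variables and set variables are named by natural numbers, in two
   separate name spaces. *)
Inductive term : Type :=
  | Var of nat
  | Zero
  | One
  | Add of term & term
  | Mul of term & term.

Inductive formula : Type :=
  | Eq of term & term
  | Lt of term & term
  | Mem of term & nat
  | Not of formula
  | And of formula & formula
  | Or of formula & formula
  | Imp of formula & formula
  | All1 of nat & formula
  | Ex1 of nat & formula
  | All2 of nat & formula
  | Ex2 of nat & formula.

Definition Iff (p q : formula) : formula := And (Imp p q) (Imp q p).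

Fixpoint occurs (x : nat) (t : term) : bool :=
  match t with
  | Var y => x == y
  | Zero | One => false
  | Add t u | Mul t u => occurs x t || occurs x u
  end.

Fixpoint free2 (X : nat) (p : formula) : bool :=
  match p with
  | Eq _ _ | Lt _ _ => false
  | Mem _ Y => X == Y
  | Not q | All1 _ q | Ex1 _ q => free2 X q
  | And q r | Or q r | Imp q r => free2 X q || free2 X r
  | All2 Y q | Ex2 Y q => (X != Y) && free2 X q
  end.

Fixpoint tsubst (x : nat) (s : term) (t : term) : term :=
  match t with
  | Var y => if x == y then s else t
  | Zero | One => t
  | Add t u => Add (tsubst x s t) (tsubst x s u)
  | Mul t u => Mul (tsubst x s t) (tsubst x s u)
  end.

(* Replaces the free occurrences of the number variable x by s, without
   renaming bound variables.  It is only used for s whose variables are among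
   {x}, and then no capture can occur. *)
Fixpoint subst (x : nat) (s : term) (p : formula) : formula :=
  match p with
  | Eq t u => Eq (tsubst x s t) (tsubst x s u)
  | Lt t u => Lt (tsubst x s t) (tsubst x s u)
  | Mem t Y => Mem (tsubst x s t) Y
  | Not q => Not (subst x s q)
  | And q r => And (subst x s q) (subst x s r)
  | Or q r => Or (subst x s q) (subst x s r)
  | Imp q r => Imp (subst x s q) (subst x s r)
  | All1 y q => if x == y then p else All1 y (subst x s q)
  | Ex1 y q => if x == y then p else Ex1 y (subst x s q)
  | All2 Y q => All2 Y (subst x s q)
  | Ex2 Y q => Ex2 Y (subst x s q)
  end.

Inductive arithmetical : formula -> Prop :=
  | ArEq t u : arithmetical (Eq t u)
  | ArLt t u : arithmetical (Lt t u)
  | ArMem t X : arithmetical (Mem t X)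
  | ArNot p : arithmetical p -> arithmetical (Not p)
  | ArAnd p q : arithmetical p -> arithmetical q -> arithmetical (And p q)
  | ArOr p q : arithmetical p -> arithmetical q -> arithmetical (Or p q)
  | ArImp p q : arithmetical p -> arithmetical q -> arithmetical (Imp p q)
  | ArAll x p : arithmetical p -> arithmetical (All1 x p)
  | ArEx x p : arithmetical p -> arithmetical (Ex1 x p).

(* Formulas all of whose quantifiers are bounded number quantifiers; set
   variables may occur free. *)
Inductive Delta00 : formula -> Prop :=
  | DEq t u : Delta00 (Eq t u)
  | DLt t u : Delta00 (Lt t u)
  | DMem t X : Delta00 (Mem t X)
  | DNot p : Delta00 p -> Delta00 (Not p)
  | DAnd p q : Delta00 p -> Delta00 q -> Delta00 (And p q)
  | DOr p q : Delta00 p -> Delta00 q -> Delta00 (Or p q)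
  | DImp p q : Delta00 p -> Delta00 q -> Delta00 (Imp p q)
  | DAll x t p : ~~ occurs x t -> Delta00 p ->
      Delta00 (All1 x (Imp (Lt (Var x) t) p))
  | DEx x t p : ~~ occurs x t -> Delta00 p ->
      Delta00 (Ex1 x (And (Lt (Var x) t) p)).

Inductive Sigma01 : formula -> Prop :=
  | SigmaEx x p : Delta00 p -> Sigma01 (Ex1 x p).

Inductive Pi01 : formula -> Prop :=
  | PiAll x p : Delta00 p -> Pi01 (All1 x p).

(* Axioms may have free variables; they stand for their universal closures
   (see [models] below). *)

Definition succ (t : term) : term := Add t One.

Inductive basic_axiom : formula -> Prop :=
  | BSuccNe0 m : basic_axiom (Not (Eq (succ (Var m)) Zero))
  | BSuccInj m n :
      basic_axiom (Imp (Eq (succ (Var m)) (succ (Var n))) (Eq (Var m) (Var n)))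
  | BAdd0 m : basic_axiom (Eq (Add (Var m) Zero) (Var m))
  | BAddS m n :
      basic_axiom (Eq (Add (Var m) (succ (Var n))) (succ (Add (Var m) (Var n))))
  | BMul0 m : basic_axiom (Eq (Mul (Var m) Zero) Zero)
  | BMulS m n :
      basic_axiom (Eq (Mul (Var m) (succ (Var n)))
                      (Add (Mul (Var m) (Var n)) (Var m)))
  | BLt0 m : basic_axiom (Not (Lt (Var m) Zero))
  | BLtS m n :
      basic_axiom (Iff (Lt (Var m) (succ (Var n)))
                       (Or (Lt (Var m) (Var n)) (Eq (Var m) (Var n)))).

Definition induction (n : nat) (p : formula) : formula :=
  Imp (And (subst n Zero p) (All1 n (Imp p (subst n (succ (Var n)) p))))
      (All1 n p).

Definition comprehension (X n : nat) (p : formula) : formula :=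
  Ex2 X (All1 n (Iff (Mem (Var n) X) p)).

Inductive RCA0 : formula -> Prop :=
  | RCA0_basic p : basic_axiom p -> RCA0 p
  | RCA0_induction n p : Sigma01 p -> RCA0 (induction n p)
  | RCA0_comprehension X n p q : Sigma01 p -> Pi01 q -> ~~ free2 X p ->
      RCA0 (Imp (All1 n (Iff p q)) (comprehension X n p)).

Inductive ACA : formula -> Prop :=
  | ACA_comprehension X n p : arithmetical p -> ~~ free2 X p ->
      ACA (comprehension X n p).

(* Sets of natural numbers, identified with points of 2^omega through their
   characteristic functions. *)
Definition cantor : Type := nat -> bool.

(* The first order part is the standard [nat]; only the domain of the set
   variables, nonempty as any domain, has to be given. *)
Record omega_model : Type := OmegaModel {
  sets :> cantor -> Prop;
  sets_inhabited : exists A, sets A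
}.

Definition update (T : Type) (e : nat -> T) (x : nat) (a : T) : nat -> T :=
  fun y => if y == x then a else e y.

Fixpoint teval (e : nat -> nat) (t : term) : nat :=
  match t with
  | Var x => e x
  | Zero => 0
  | One => 1
  | Add t u => teval e t + teval e u
  | Mul t u => teval e t * teval e u
  end.

Fixpoint sat (M : omega_model) (e : nat -> nat) (E : nat -> cantor)
    (p : formula) : Prop :=
  match p with
  | Eq t u => teval e t = teval e u
  | Lt t u => teval e t < teval e u
  | Mem t X => E X (teval e t)
  | Not q => ~ sat M e E q
  | And q r => sat M e E q /\ sat M e E r
  | Or q r => sat M e E q \/ sat M e E r
  | Imp q r => sat M e E q -> sat M e E r
  | All1 x q => forall a : nat, sat M (update e x a) E q
  | Ex1 x q => exists a : nat, sat M (update e x a) E q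
  | All2 X q => forall A : cantor, M A -> sat M e (update E X A) q
  | Ex2 X q => exists A : cantor, M A /\ sat M e (update E X A) q
  end.

Definition models (M : omega_model) (T : formula -> Prop) : Prop :=
  forall p, T p -> forall (e : nat -> nat) (E : nat -> cantor),
    (forall X, M (E X)) -> sat M e E p.

Definition str : Type := seq bool.

(* Bijective base 2: a bijection from finite binary strings to numbers. *)
Definition code (s : str) : nat :=
  foldr (fun (b : bool) n => n.*2 + b.+1) 0 s.

Definition pair_code (i j : nat) : nat := (i + j) ^ 2 + i.

(* The set of natural numbers that codes f. *)
Definition graph (f : str -> str) : cantor :=
  fun n => `[< exists s, n = pair_code (code s) (code (f s)) >].

Definition restr (X : cantor) (n : nat) : str := mkseq X n.

(* A set C of numbers is read as the set of the strings s with [C (code s)]. *)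
Definition is_tree (C : cantor) : Prop :=
  forall s t : str, prefix s t -> C (code t) -> C (code s).

Definition is_path (C X : cantor) : Prop := forall n, C (code (restr X n)).

Definition encodes_transformation (f : str -> str) : Prop :=
  [/\ forall s t, prefix s t -> prefix (f s) (f t),
      forall l, exists m, forall s, size s = m -> l <= size (f s)
    & forall s, s <> [::] -> size (f s) < size s].

(* The limit of a sequence of strings: bit i is the eventual value of the i-th
   entry of u l.  For l |-> f^k(X|l) with f as above, every entry is eventually
   defined and constant, and the limit is computable from f and X.  Then
   [transf f k X] is F^k(X). *)
Definition lim_str (u : nat -> str) : cantor :=
  fun i => `[< exists l0, forall l, l0 <= l -> onth (u l) i = Some true >].

Definition transf (f : str -> str) (k : nat) (X : cantor) : cantor :=
  lim_str (fun l => iter k f (restr X l)).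

(* Set quantifiers range over M, here and in [models_AP]: "[C] is nonempty"
   means that M contains a path through C. *)
Definition is_system (M : omega_model) (C : cantor) (f : str -> str) : Prop :=
  [/\ is_tree C,
      encodes_transformation f,
      exists X, M X /\ is_path C X
    & forall s, C (code s) -> C (code (f s))].

Definition almost_periodic (C : cantor) (f : str -> str) (X : cantor) : Prop :=
  is_path C X /\
  forall c, exists b, forall n, exists2 k, k < b &
    restr (transf f (n + k) X) c = restr X c.

(* M satisfies AP.  The number quantifiers in the definition of AP range over
   the standard numbers, so the part of it without set quantifiers has the same
   meaning in M as outside. *)
Definition models_AP (M : omega_model) : Prop :=
  forall (C : cantor) (f : str -> str), M C -> M (graph f) ->
    is_system M C f -> exists X, M X /\ almost_periodic C f X.

(* Main.v *)
From HB Require Import structures.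
From mathcomp Require Import all_boot boolp zify.
Require Import Defs.

Set Implicit Arguments.
Unset Strict Implicit.
Unset Printing Implicit Defensive.

(** The model is the union of an increasing sequence of ideals of sets, each
    obtained from the previous one by adjoining one almost periodic point; no
    stage computes a fixed set A that is arithmetical in the first stage.

    Computability can be replaced by any countable class of continuous
    functionals with the right closure properties.  A [name] denotes a relation
    between a number and a sequence E of sets that is open in E; the names are
    closed under disjunction, composition, Sigma-0-1 formulas, quantification
    over a point of Cantor space (the result is still open, by [compactness]),
    and passing from an open set u to the set of points whose orbit enters u.
    A set B is computable from E when B and its complement both have a name
    evaluated at E.  These closure properties give Delta-0-1 comprehension
    ([computable_Delta01]), and the countability of the names allows
    diagonalization.

    First stage ([incomputable_columns]): a finite extension argument builds G
    such that A = {x : G has an element in column x} is not computable from G.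
    Since A is defined from G with one quantifier, a model that contains G but
    not A fails arithmetical comprehension.

    Successor stage ([almost_periodic_avoiding]): let (C, f) be a system
    computable from E, with transformation F, and let A be incomputable from E.
    A condition is a pair (D, s) where D is a nonempty F-invariant subset of [C]
    whose complement has a name, s is a string, and every orbit in D enters the
    cylinder [s]; it is extended by shrinking D and lengthening s.  Let X be the
    union of the strings of a generic sequence of conditions.  Every D of the
    sequence is closed and meets all the cylinders around X, so X lies in D.  As
    every orbit in D enters [s], compactness bounds the waiting time uniformly;
    applied to the points F^n(X), which belong to D, this is almost periodicity.

    To keep a pair of names from computing A ([decide]), let u(x, b) be the open
    set of the points of [s] from which the pair computes the value b at x.  If
    for some x the points of D whose orbits avoid u(x, A x) form a nonempty set,
    restrict D to it.  If for some x every orbit in D enters u(x, 1 - A x), then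
    D and s can be changed so that the new cylinder lies inside u(x, 1 - A x)
    ([shrink]).  Otherwise A x = b iff every orbit in D enters u(x, b), which has
    a name by compactness, and A would be computable from E. *)

(** * Finite approximations and compactness of Cantor space *)

Definition env : Type := nat -> cantor.
Definition agree (N : nat) (X Y : cantor) := forall i, i < N -> X i = Y i.
Definition env_agree (N : nat) (E E' : env) :=
  forall i j, i < N -> j < N -> E i j = E' i j.
Definition open (U : cantor -> Prop) :=
  forall X, U X -> exists N, forall Y, agree N X Y -> U Y.
Definition env_open (R : env -> Prop) :=
  forall E, R E -> exists N, forall E', env_agree N E E' -> R E'.
Definition jointly_open (R : cantor -> env -> Prop) :=
  forall X E, R X E ->
    exists N, forall X' E', agree N X X' -> env_agree N E E' -> R X' E'.
Definition below (s : str) (X : cantor) := restr X (size s) = s.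

Lemma agreeW M N X Y : M <= N -> agree N X Y -> agree M X Y.
Proof. by move=> le H i iM; apply: H; apply: leq_trans le. Qed.

Lemma env_agreeW M N E E' : M <= N -> env_agree N E E' -> env_agree M E E'.
Proof. by move=> le H i j iM jM; apply: H; apply: leq_trans le. Qed.

Lemma agree_sym N X Y : agree N X Y -> agree N Y X.
Proof. by move=> H i iN; rewrite H. Qed.
Lemma agree_trans N X Y Z : agree N X Y -> agree N Y Z -> agree N X Z.
Proof. by move=> H K i iN; rewrite H // K. Qed.

Lemma size_restr X n : size (restr X n) = n.
Proof. exact: size_mkseq. Qed.

Lemma restrP X Y n : restr X n = restr Y n <-> agree n X Y.
Proof.
split=> [e i lin | H].
  by rewrite -(nth_mkseq false X lin) -(nth_mkseq false Y lin) -/(restr _ _) e.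
by apply/eq_in_map => i; rewrite mem_iota /= => /H.
Qed.

Lemma belowP s X : below s X <-> forall i, i < size s -> X i = nth false s i.
Proof.
split=> [e i lis | H]; first by rewrite -[in RHS]e nth_mkseq.
apply: (@eq_from_nth _ false); first by rewrite size_restr.
by move=> i; rewrite size_restr => lis; rewrite nth_mkseq // H.
Qed.

Lemma below_agree s X Y : agree (size s) X Y -> below s X -> below s Y.
Proof. by move=> H; rewrite /below => <-; rewrite size_restr; apply/restrP/agree_sym. Qed.

Lemma below_restr X n : below (restr X n) X.
Proof. by rewrite /below size_restr. Qed.

Lemma below_prefix s t X : prefix s t -> below t X -> below s X.
Proof.
case/prefixP=> u -> /belowP H; apply/belowP=> i lis.
rewrite H ?nth_cat ?lis // size_cat.
exact: leq_trans lis (leq_addr _ _).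
Qed.

Lemma below_leq s t X :
  below s X -> below t X -> size s <= size t -> prefix s t.
Proof.
move=> /belowP Hs /belowP Ht le; rewrite prefixE; apply/eqP.
apply: (@eq_from_nth _ false); first by rewrite size_takel.
move=> i; rewrite size_takel // => lis.
by rewrite nth_take // -Hs // Ht // (leq_trans lis).
Qed.

Lemma prefix_restr X m n : m <= n -> prefix (restr X m) (restr X n).
Proof. by move=> le; apply: (@below_leq _ _ X); rewrite ?size_restr //; apply: below_restr. Qed.

(** The strings whose cylinder is covered by no V N form a tree without dead
    ends, hence with a path as soon as the root belongs to it. *)
Theorem compactness (V : nat -> cantor -> Prop) :
  (forall N, open (V N)) -> (forall M N X, M <= N -> V M X -> V N X) ->
  (forall X, exists N, V N X) -> exists N, forall X, V N X.
Proof.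
move=> opV monV covV; apply: contrapT => noN.
pose T s := forall N, exists X, below s X /\ ~ V N X.
have T0 : T [::].
  move=> N; apply: contrapT => H; apply: noN; exists N => X.
  by apply: contrapT => nV; apply: H; exists X.
have TS s : T s -> ~ T (rcons s false) -> T (rcons s true).
  move=> Ts /existsNP [M HM] N; case: (Ts (maxn M N)) => X [sX nV].
  exists X; split; last by move=> /monV; apply: contra_not nV; apply; lia.
  have: ~ below (rcons s false) X.
    move=> sX'; apply: HM; exists X; split=> //.
    by move=> /monV; apply: contra_not nV; apply; lia.
  move/belowP: sX => sX sX'; apply/belowP => i; rewrite size_rcons ltnS => lis.
  rewrite nth_rcons; case: ltngtP lis => // [lis _ | eis _]; first exact: sX.
  subst i; apply/negPn/negP => Xf; apply: sX'; apply/belowP => j.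
  rewrite size_rcons ltnS nth_rcons; case: ltngtP => // [ljs _ | -> _]; first exact: sX.
  exact: negbTE.
pose g s := rcons s `[< ~ T (rcons s false) >].
pose r n := iter n g [::].
have Tr n : T (r n).
  elim: n => //= n IH; rewrite /g; case: asboolP => [/TS|/contrapT //]; exact.
have szr n : size (r n) = n by elim: n => //= n IH; rewrite size_rcons -/(r n) IH.
pose X : cantor := fun n => nth false (r n.+1) n.
have rX n : below (r n) X.
  elim: n => [|n IH] //; apply/belowP => i; rewrite szr ltnS leq_eqVlt.
  case/orP=> [/eqP -> // | lin]; move/belowP: IH => ->; last by rewrite szr.
  by rewrite /= nth_rcons szr lin.
have [N VX] := covV X; have [l Hl] := opV _ _ VX.
have [Y [rY]] := Tr l N; apply; apply: Hl; apply/restrP.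
by move: (rX l) rY; rewrite /below szr => -> ->.
Qed.

(** The tube lemma: universal quantification over a compact space preserves
    openness. *)
Lemma env_open_all R : jointly_open R -> env_open (fun E => forall Y, R Y E).
Proof.
move=> opR E HE.
pose V N Y := exists2 M, M <= N &
  forall Y' E', agree M Y Y' -> env_agree M E E' -> R Y' E'.
have [||Y|N HN] := @compactness V.
- move=> N Y [M le HM]; exists M => Z YZ; exists M => // Y' E' ZY' EE'.
  by apply: HM => //; apply: agree_trans YZ ZY'.
- by move=> M N Y le [L le' HL]; exists L => //; apply: leq_trans le.
- by have [N HN] := opR _ _ (HE Y); exists N; exists N.
exists N => E' EE' Y; have [M le HM] := HN Y.
by apply: HM => //; apply: env_agreeW EE'.
Qed.

Lemma update_eq T (e : nat -> T) x a : update e x a x = a.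
Proof. by rewrite /update eqxx. Qed.

Lemma update_neq T (e : nat -> T) x y a : y != x -> update e x a y = e y.
Proof. by rewrite /update => /negbTE ->. Qed.

Lemma env_agree_update N k E E' Y Y' :
  env_agree N E E' -> agree N Y Y' -> env_agree N (update E k Y) (update E' k Y').
Proof. by move=> H K i j iN jN; rewrite /update; case: eqP => _; [apply: K | apply: H]. Qed.

(** Codes a sequence of sets by one set, so that whole orbits can be quantified
    over as single points of Cantor space. *)
Definition col (O : cantor) (i : nat) : cantor := fun m => O (pickle (i, m)).

Lemma col_cont i l : exists N, forall O O', agree N O O' -> agree l (col O i) (col O' i).
Proof.
exists (\max_(m < l) (pickle (i, m : nat)).+1) => O O' H m lm; apply: H.
exact: (leq_bigmax (Ordinal lm)).
Qed.

Lemma col_surj (S : nat -> cantor) : exists O, forall i, col O i = S i.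
Proof.
exists (fun n => if unpickle n is Some (i, m) then S i m else false) => i.
by apply: funext => m; rewrite /col pickleK.
Qed.

(** * Countability and semantics of formulas *)

Fixpoint term_tree (t : term) : GenTree.tree nat :=
  match t with
  | Var x => GenTree.Leaf x
  | Zero => GenTree.Node 0 [::]
  | One => GenTree.Node 1 [::]
  | Add t u => GenTree.Node 2 [:: term_tree t; term_tree u]
  | Mul t u => GenTree.Node 3 [:: term_tree t; term_tree u]
  end.

Fixpoint tree_term (t : GenTree.tree nat) : term :=
  match t with
  | GenTree.Leaf x => Var x
  | GenTree.Node 1 _ => One
  | GenTree.Node 2 [:: t; u] => Add (tree_term t) (tree_term u)
  | GenTree.Node 3 [:: t; u] => Mul (tree_term t) (tree_term u)
  | _ => Zero
  end.

Lemma term_treeK : cancel term_tree tree_term.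
Proof. by elim=> //= [t -> u ->|t -> u ->]. Qed.

HB.instance Definition _ := Countable.copy term (can_type term_treeK).

Definition leaf (T : countType) (x : T) : GenTree.tree nat :=
  GenTree.Leaf (pickle x).

Fixpoint formula_tree (p : formula) : GenTree.tree nat :=
  match p with
  | Eq t u => GenTree.Node 0 [:: leaf (t, u)]
  | Lt t u => GenTree.Node 1 [:: leaf (t, u)]
  | Mem t X => GenTree.Node 2 [:: leaf (t, X)]
  | Not q => GenTree.Node 3 [:: formula_tree q]
  | And q r => GenTree.Node 4 [:: formula_tree q; formula_tree r]
  | Or q r => GenTree.Node 5 [:: formula_tree q; formula_tree r]
  | Imp q r => GenTree.Node 6 [:: formula_tree q; formula_tree r]
  | All1 x q => GenTree.Node 7 [:: leaf x; formula_tree q]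
  | Ex1 x q => GenTree.Node 8 [:: leaf x; formula_tree q]
  | All2 X q => GenTree.Node 9 [:: leaf X; formula_tree q]
  | Ex2 X q => GenTree.Node 10 [:: leaf X; formula_tree q]
  end.

Fixpoint tree_formula (t : GenTree.tree nat) : option formula :=
  match t with
  | GenTree.Node 0 [:: GenTree.Leaf n] =>
      omap (fun x : term * term => Eq x.1 x.2) (unpickle n)
  | GenTree.Node 1 [:: GenTree.Leaf n] =>
      omap (fun x : term * term => Lt x.1 x.2) (unpickle n)
  | GenTree.Node 2 [:: GenTree.Leaf n] =>
      omap (fun x : term * nat => Mem x.1 x.2) (unpickle n)
  | GenTree.Node 3 [:: t] => omap Not (tree_formula t)
  | GenTree.Node 4 [:: t; u] =>
      obind (fun q => omap (And q) (tree_formula u)) (tree_formula t)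
  | GenTree.Node 5 [:: t; u] =>
      obind (fun q => omap (Or q) (tree_formula u)) (tree_formula t)
  | GenTree.Node 6 [:: t; u] =>
      obind (fun q => omap (Imp q) (tree_formula u)) (tree_formula t)
  | GenTree.Node 7 [:: GenTree.Leaf n; t] =>
      obind (fun x => omap (All1 x) (tree_formula t)) (unpickle n)
  | GenTree.Node 8 [:: GenTree.Leaf n; t] =>
      obind (fun x => omap (Ex1 x) (tree_formula t)) (unpickle n)
  | GenTree.Node 9 [:: GenTree.Leaf n; t] =>
      obind (fun x => omap (All2 x) (tree_formula t)) (unpickle n)
  | GenTree.Node 10 [:: GenTree.Leaf n; t] =>
      obind (fun x => omap (Ex2 x) (tree_formula t)) (unpickle n)
  | _ => None
  end.

Lemma formula_treeK : pcancel formula_tree tree_formula.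
Proof.
elim=> //= *; rewrite ?pickleK //=;
by repeat match goal with H : _ = Some _ |- _ => rewrite H /= end.
Qed.

HB.instance Definition _ := Countable.copy formula (pcan_type formula_treeK).

Definition fullM : omega_model :=
  @OmegaModel (fun _ => True) (ex_intro _ (fun _ => false) I).

Lemma eq_teval e e' t :
  (forall x, occurs x t -> e x = e' x) -> teval e t = teval e' t.
Proof.
elim: t => //= [x H|t IHt u IHu H|t IHt u IHu H]; first exact: H.
- by rewrite IHt ?IHu // => x Hx; apply: H; rewrite Hx ?orbT.
- by rewrite IHt ?IHu // => x Hx; apply: H; rewrite Hx ?orbT.
Qed.

Lemma teval_update e x a t : ~~ occurs x t -> teval (update e x a) t = teval e t.
Proof.
move=> nx; apply: eq_teval => y; apply: contraTeq => /eqP; rewrite /update.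
by case: eqP => [->|].
Qed.

Lemma updateC T (e : nat -> T) x y a b :
  x != y -> update (update e x a) y b = update (update e y b) x a.
Proof.
move=> xy; apply: funext => z; rewrite /update.
by case: (z =P y) => // ->; rewrite eq_sym (negbTE xy).
Qed.

Lemma update_same T (e : nat -> T) x a b : update (update e x a) x b = update e x b.
Proof. by apply: funext => z; rewrite /update; case: eqP. Qed.

Lemma update_id T (e : nat -> T) x : update e x (e x) = e.
Proof. by apply: funext => z; rewrite /update; case: eqP => [->|]. Qed.

Lemma teval_subst e x s t : teval e (tsubst x s t) = teval (update e x (teval e s)) t.
Proof.
elim: t => //= [y|t -> u ->|t -> u ->] //.
by rewrite /update eq_sym; case: eqP.
Qed.

(** The hypothesis on s is what excludes capture: a bound variable other than x
    does not occur in s. *)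
Lemma sat_subst M e E x s p : (forall y, occurs y s -> y = x) ->
  sat M e E (subst x s p) <-> sat M (update e x (teval e s)) E p.
Proof.
move=> sx.
have qcase (e' : nat -> nat) y a : (x == y) = false ->
  update (update e' y a) x (teval (update e' y a) s)
    = update (update e' x (teval e' s)) y a.
  move=> xy; rewrite updateC; last by rewrite eq_sym xy.
  by rewrite teval_update //; apply/negP => /sx yx; rewrite yx eqxx in xy.
elim: p e E => /= [t u|t u|t X|q IH|q IH r IH'|q IH r IH'|q IH r IH'
                  |y q IH|y q IH|X q IH|X q IH] e E.
- by rewrite !teval_subst.
- by rewrite !teval_subst.
- by rewrite !teval_subst.
- by rewrite IH.
- by rewrite IH IH'.
- by rewrite IH IH'.
- by rewrite IH IH'.
- case: ifP => /= [/eqP <-|xy]; first by split=> H a; move: (H a); rewrite update_same.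
  by split=> H a; move: (H a); rewrite IH qcase.
- case: ifP => /= [/eqP <-|xy]; first by split=> -[a H]; exists a; rewrite update_same in H *.
  by split=> -[a H]; exists a; move: H; rewrite IH qcase.
- by split=> H A MA; apply/IH/H.
- by split=> -[A [MA H]]; exists A; split=> //; apply/IH.
Qed.

Lemma models_basic M p e E : basic_axiom p -> sat M e E p.
Proof. by case=> /= *; rewrite ?addn1 ?addn0 ?addnS ?muln0 ?mulnS //; lia. Qed.

Lemma models_induction M n p e E : sat M e E (induction n p).
Proof.
rewrite /induction /= => -[H0 HS]; elim=> [|a IH].
  by move: H0; rewrite sat_subst.
have := HS a IH; rewrite sat_subst => [|y /=]; last by rewrite orbF => /eqP.
by rewrite /= update_eq update_same addn1.
Qed.

(** * Dependence of satisfaction on the assignments *)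

Lemma sat_free2 M p e E E' : (forall X, free2 X p -> E X = E' X) ->
  sat M e E p <-> sat M e E' p.
Proof.
elim: p e E E' => //= [t X|q IH|q IH r IH'|q IH r IH'|q IH r IH'
                      |y q IH|y q IH|X q IH|X q IH] e E E' H.
- by rewrite H.
- by rewrite (IH _ _ E').
- by rewrite (IH _ _ E') ?(IH' _ _ E') // => X HX; apply: H; rewrite HX ?orbT.
- by rewrite (IH _ _ E') ?(IH' _ _ E') // => X HX; apply: H; rewrite HX ?orbT.
- by rewrite (IH _ _ E') ?(IH' _ _ E') // => X HX; apply: H; rewrite HX ?orbT.
- by split=> K a; have := K a; rewrite (IH _ E E').
- by split=> -[a K]; exists a; move: K; rewrite (IH _ E E').
- have HA A Y : free2 Y q -> update E X A Y = update E' X A Y.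
    by rewrite /update; case: eqP => // /eqP YX HY; apply: H; rewrite YX.
  by split=> K A MA; have := K A MA; rewrite (IH _ _ _ (HA A)).
- have HA A Y : free2 Y q -> update E X A Y = update E' X A Y.
    by rewrite /update; case: eqP => // /eqP YX HY; apply: H; rewrite YX.
  by split=> -[A [MA K]]; exists A; split=> //; move: K; rewrite (IH _ _ _ (HA A)).
Qed.

Lemma free2_bound p : exists N, forall X, free2 X p -> X < N.
Proof.
elim: p => /= [t u|t u|t X|q [N H]|q [N H] r [N' H']|q [N H] r [N' H']
  |q [N H] r [N' H']|y q [N H]|y q [N H]|X q [N H]|X q [N H]].
all: try by exists 0.
all: try by exists N.
all: try by exists (maxn N N') => X /orP[/H|/H']; rewrite leq_max => -> //; rewrite orbT.
- by exists X.+1 => Y /eqP ->.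
- by exists N => Y /andP[_ /H].
- by exists N => Y /andP[_ /H].
Qed.

Lemma occurs_bound t : exists N, forall x, occurs x t -> x < N.
Proof.
elim: t => /= [y|||t [N H] u [N' H']|t [N H] u [N' H']].
all: try by exists 0.
- by exists y.+1 => x /eqP ->.
all: by exists (maxn N N') => X /orP[/H|/H']; rewrite leq_max => -> //; rewrite orbT.
Qed.

Lemma sat_bound p : exists N, forall M e e' E, (forall x, x < N -> e x = e' x) ->
  sat M e E p <-> sat M e' E p.
Proof.
have T t : exists N, forall e e', (forall x, x < N -> e x = e' x) -> teval e t = teval e' t.
  by have [N HN] := occurs_bound t; exists N => e e' H; apply: eq_teval => x /HN /H.
have U (e e' : nat -> nat) y a N : (forall x, x < N -> e x = e' x) ->
    forall x, x < N -> update e y a x = update e' y a x.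
  by move=> H x /H; rewrite /update; case: eqP.
have ML (e e' : nat -> nat) N N' : (forall x, x < maxn N N' -> e x = e' x) ->
    (forall x, x < N -> e x = e' x) /\ (forall x, x < N' -> e x = e' x).
  by move=> H; split=> x xN; apply: H; rewrite leq_max xN ?orbT.
elim: p => /= [t u|t u|t X|q [N H]|q [N H] r [N' H']|q [N H] r [N' H']
  |q [N H] r [N' H']|y q [N H]|y q [N H]|X q [N H]|X q [N H]].
- have [N HN] := T t; have [N' HN'] := T u; exists (maxn N N') => M e e' E /ML[K K'].
  by rewrite (HN _ _ K) (HN' _ _ K').
- have [N HN] := T t; have [N' HN'] := T u; exists (maxn N N') => M e e' E /ML[K K'].
  by rewrite (HN _ _ K) (HN' _ _ K').
- by have [N HN] := T t; exists N => M e e' E /HN ->.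
- by exists N => M e e' E K; rewrite (H _ _ _ _ K).
- by exists (maxn N N') => M e e' E /ML[K K']; rewrite (H _ _ _ _ K) (H' _ _ _ _ K').
- by exists (maxn N N') => M e e' E /ML[K K']; rewrite (H _ _ _ _ K) (H' _ _ _ _ K').
- by exists (maxn N N') => M e e' E /ML[K K']; rewrite (H _ _ _ _ K) (H' _ _ _ _ K').
- by exists N => M e e' E K; split=> HH a; have := HH a; rewrite (H _ _ _ _ (U _ _ y a _ K)).
- exists N => M e e' E K; split=> -[a HH]; exists a; move: HH;
  by rewrite (H _ _ _ _ (U _ _ y a _ K)).
- by exists N => M e e' E K; split=> HH A MA; have := HH A MA; rewrite (H _ _ _ _ K).
- exists N => M e e' E K; split=> -[A [MA HH]]; exists A; split=> //; move: HH;
  by rewrite (H _ _ _ _ K).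
Qed.

(** A bounded formula only inspects finitely many bits of its parameters, and it
    has no set quantifier that would depend on the model. *)
Lemma Delta00_cont p : Delta00 p -> forall e E, exists N, forall M M' E',
  env_agree N E E' -> (sat M e E p <-> sat M' e E' p).
Proof.
have bounded q x e E k : (forall e E, exists N, forall M M' E',
      env_agree N E E' -> (sat M e E q <-> sat M' e E' q)) ->
    exists N, forall M M' E' a, a < k -> env_agree N E E' ->
      (sat M (update e x a) E q <-> sat M' (update e x a) E' q).
  move=> IH; elim: k => [|k [N H]]; first by exists 0.
  have [N' H'] := IH (update e x k) E; exists (maxn N N') => M M' E' a.
  rewrite ltnS leq_eqVlt => /orP[/eqP ->|lak] EE'.
    by apply: H'; apply: env_agreeW EE'; rewrite leq_maxr.
  by apply: H => //; apply: env_agreeW EE'; rewrite leq_maxl.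
elim=> {p} /= [t u|t u|t X|q _ IH|q r _ IH _ IH'|q r _ IH _ IH'
  |q r _ IH _ IH'|x t q xt _ IH|x t q xt _ IH] e E.
- by exists 0.
- by exists 0.
- exists (maxn X (teval e t)).+1 => M M' E' H.
  by rewrite (H X (teval e t)) // ltnS ?leq_maxl ?leq_maxr.
- by have [N H] := IH e E; exists N => M M' E' /(H M M') ->.
all: try by have [N H] := IH e E; have [N' H'] := IH' e E;
  exists (maxn N N') => M M' E' EE'; rewrite (H M M' E') ?(H' M M' E') //;
  apply: env_agreeW EE'; rewrite ?leq_maxl ?leq_maxr.
all: have [N H] := bounded q x e E (teval e t) IH.
- exists N => M M' E' EE'; split=> K a; have := K a; rewrite update_eq teval_update //.
    by move=> K' lat; apply/(H M M' E' a lat EE'); apply: K'.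
  by move=> K' lat; apply/(H M M' E' a lat EE'); apply: K'.
- exists N => M M' E' EE'; split=> -[a]; rewrite update_eq teval_update // => -[lat K];
  exists a; rewrite update_eq teval_update //; split=> //.
    by apply/(H M M' E' a lat EE').
  by apply/(H M M' E' a lat EE').
Qed.

(** The interior of the truth set of p, for every p; thus formulas can be used
    as names without any syntactic restriction. *)
Definition forced (e : nat -> nat) (E : env) (p : formula) :=
  exists N, forall E', env_agree N E E' -> sat fullM e E' p.

Lemma env_open_forced e p : env_open (fun E => forced e E p).
Proof.
move=> E [N H]; exists N => E' EE'; exists N => E'' E'E''; apply: H.
by move=> i j iN jN; rewrite EE' // E'E''.
Qed.

Lemma forced_Sigma01 M e E p : Sigma01 p -> forced e E p <-> sat M e E p.
Proof.
case=> x {}p Dp; split=> [[N /(_ E)] [//|a Ha]|[a Ha]].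
  exists a; have [K HK] := Delta00_cont Dp (update e x a) E.
  by apply/(HK M fullM E).
have [K HK] := Delta00_cont Dp (update e x a) E; exists K => E' EE'; exists a.
exact/(HK M fullM E' EE').
Qed.

Lemma forced_Pi01 M e E p : Pi01 p -> forced e E (Not p) <-> ~ sat M e E p.
Proof.
case=> x {}p Dp; split=> [[N /(_ E)] /= H H'|/existsNP [a Ha]].
  apply: H => // a; have [K HK] := Delta00_cont Dp (update e x a) E.
  exact/(HK M fullM E).
have [K HK] := Delta00_cont Dp (update e x a) E; exists K => E' EE' /= /(_ a) Ha'.
by apply: Ha; apply/(HK M fullM E' EE').
Qed.

(** * Names of open relations *)

Inductive name : Type :=
  | NForm of nat & seq nat & nat & formula
  | NTrunc of nat & name
  | NUse of name & name & nat & name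
  | NOr of name & name
  | NCyl of str & nat & name
  | NAll of nat & name
  | NNotPath of nat & nat
  | NVisit of nat & nat & name
  | NNum of nat & name.

Fixpoint name_tree (c : name) : GenTree.tree nat :=
  match c with
  | NForm k s n p => GenTree.Node 0 [:: leaf (k, s, n, p)]
  | NTrunc k c => GenTree.Node 1 [:: leaf k; name_tree c]
  | NUse c1 c0 i c =>
      GenTree.Node 2 [:: name_tree c1; name_tree c0; leaf i; name_tree c]
  | NOr c d => GenTree.Node 3 [:: name_tree c; name_tree d]
  | NCyl s k c => GenTree.Node 4 [:: leaf (s, k); name_tree c]
  | NAll k c => GenTree.Node 5 [:: leaf k; name_tree c]
  | NNotPath k j => GenTree.Node 6 [:: leaf (k, j)]
  | NVisit k j c => GenTree.Node 7 [:: leaf (k, j); name_tree c]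
  | NNum x c => GenTree.Node 8 [:: leaf x; name_tree c]
  end.

Fixpoint tree_name (t : GenTree.tree nat) : option name :=
  match t with
  | GenTree.Node 0 [:: GenTree.Leaf n] =>
      omap (fun x : nat * seq nat * nat * formula =>
              let: (k, s, n, p) := x in NForm k s n p) (unpickle n)
  | GenTree.Node 1 [:: GenTree.Leaf n; t] =>
      obind (fun k => omap (NTrunc k) (tree_name t)) (unpickle n)
  | GenTree.Node 2 [:: t1; t0; GenTree.Leaf n; t] =>
      obind (fun c1 => obind (fun c0 => obind (fun i =>
        omap (NUse c1 c0 i) (tree_name t)) (unpickle n))
        (tree_name t0)) (tree_name t1)
  | GenTree.Node 3 [:: t; u] =>
      obind (fun c => omap (NOr c) (tree_name u)) (tree_name t)
  | GenTree.Node 4 [:: GenTree.Leaf n; t] =>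
      obind (fun x : str * nat => omap (NCyl x.1 x.2) (tree_name t)) (unpickle n)
  | GenTree.Node 5 [:: GenTree.Leaf n; t] =>
      obind (fun k => omap (NAll k) (tree_name t)) (unpickle n)
  | GenTree.Node 6 [:: GenTree.Leaf n] =>
      omap (fun x : nat * nat => NNotPath x.1 x.2) (unpickle n)
  | GenTree.Node 7 [:: GenTree.Leaf n; t] =>
      obind (fun x : nat * nat => omap (NVisit x.1 x.2) (tree_name t)) (unpickle n)
  | GenTree.Node 8 [:: GenTree.Leaf n; t] =>
      obind (fun k => omap (NNum k) (tree_name t)) (unpickle n)
  | _ => None
  end.

Lemma name_treeK : pcancel name_tree tree_name.
Proof.
elim=> //= *; rewrite ?pickleK //=;
by repeat match goal with H : _ = Some _ |- _ => rewrite H /= end; rewrite ?pickleK.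
Qed.

HB.instance Definition _ := Countable.copy name (pcan_type name_treeK).

(** A stage of the construction uses the sets E i with i < k, and the positions
    from k on are free for auxiliary sets; truncation erases the latter before a
    name that was meant for that stage is evaluated. *)
Definition trunc (k : nat) (E : env) : env :=
  fun i => if i < k then E i else fun=> false.

(** [NUse c1 c0 i c] evaluates c with the set computed by the pair (c1, c0) at
    position i: it says that every B which is not that set is refuted by c1 or
    c0.  Written with a universal set quantifier, this stays open when c1 and c0
    compute no set at all.  In the same way [NVisit k j c], with the graph of f
    at position j, says that every sequence of points is refuted as the f-orbit
    of E k, or enters the set named by c. *)
Fixpoint holds (c : name) (a : nat) (E : env) : Prop :=
  match c with
  | NForm k s n p => forced (update (nth 0 s) n a) (fun X => E (k + X)) p
  | NTrunc k c => holds c a (trunc k E)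
  | NUse c1 c0 i c => forall B : cantor,
      [\/ exists n, B n /\ holds c0 n E,
          exists n, ~~ B n /\ holds c1 n E
        | holds c a (update E i B)]
  | NOr c d => holds c a E \/ holds d a E
  | NCyl s k c => below s (E k) /\ holds c a E
  | NAll k c => forall Y, holds c a (update E k Y)
  | NNotPath k j => exists n, ~~ E j (code (restr (E k) n))
  | NVisit k j c => forall O : cantor,
      [\/ exists i s t, [/\ E j (pair_code (code s) (code t)),
                            below s (col O i) & ~ below t (col O i.+1)],
          exists m, col O 0 m <> E k m
        | exists i, holds c a (update E k (col O i))]
  | NNum x c => holds c x E
  end.

Lemma env_open_holds c a : env_open (holds c a).
Proof.
elim: c a => [k s n p|k c IH|c1 IH1 c0 IH0 i c IH|c IHc d IHd|s k c IH|k c IH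
  |k j|k j c IH|x c IH] a /=.
- move=> E /env_open_forced [N H]; exists (k + N) => E' EE'; apply: H => i j iN jN.
  by apply: EE'; lia.
- move=> E /IH [N H]; exists N => E' EE'; apply: H => i j iN jN.
  by rewrite /trunc; case: ifP => // _; apply: EE'.
- apply: env_open_all => B E [[n [Bn /IH0 [N H]]]|[n [Bn /IH1 [N H]]]|/IH [N H]].
  + exists (maxn n.+1 N) => B' E' BB' EE'; constructor 1; exists n; split.
      by rewrite -BB' // leq_max leqnn.
    by apply: H; apply: env_agreeW EE'; rewrite leq_maxr.
  + exists (maxn n.+1 N) => B' E' BB' EE'; constructor 2; exists n; split.
      by rewrite -BB' // leq_max leqnn.
    by apply: H; apply: env_agreeW EE'; rewrite leq_maxr.
  + by exists N => B' E' BB' EE'; constructor 3; apply: H; apply: env_agree_update.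
- by move=> E [/IHc [N H]|/IHd [N H]]; exists N => E' /H; [left|right].
- move=> E [sE /IH [N H]]; exists (maxn (maxn k.+1 (size s)) N) => E' EE'; split.
    apply: below_agree sE => i lis; apply: EE'; first by rewrite !leq_max leqnn.
    by rewrite (leq_trans lis) // !leq_max leqnn orbT.
  by apply: H; apply: env_agreeW EE'; rewrite leq_maxr.
- apply: env_open_all => Y E /IH [N H]; exists N => Y' E' YY' EE'; apply: H.
  exact: env_agree_update.
- move=> E [n Hn].
  exists (maxn (maxn j.+1 k.+1) (maxn (code (restr (E k) n)).+1 n)) => E' EE'.
  exists n.
  have <- : E j (code (restr (E k) n)) = E' j (code (restr (E' k) n)).
    have -> : restr (E' k) n = restr (E k) n.
      by apply/restrP => i lin; rewrite EE' //; lia.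
    by apply: EE'; lia.
  by [].
- apply: env_open_all => O E [[i [s [t [Ej sO tO]]]]|[m Om]|[i /IH [N H]]].
  + have [N H] := col_cont i (size s); have [N' H'] := col_cont i.+1 (size t).
    exists (maxn (maxn N N') (maxn j.+1 (pair_code (code s) (code t)).+1)) => O' E' OO' EE'.
    constructor 1; exists i, s, t; split.
    * by rewrite -EE' //; lia.
    * by apply: below_agree sO; apply: H; apply: agreeW OO'; lia.
    * move=> tO'; apply: tO; apply: below_agree tO'; apply: agree_sym.
      by apply: H'; apply: agreeW OO'; lia.
  + have [N H] := col_cont 0 m.+1; exists (maxn N (maxn k.+1 m.+1)) => O' E' OO' EE'.
    constructor 2; exists m; rewrite -EE'; try lia.
    by rewrite -(H O O') //; apply: agreeW OO'; lia.
  + have [N' H'] := col_cont i N; exists (maxn N N') => O' E' OO' EE'.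
    constructor 3; exists i; apply: H; apply: env_agree_update.
      by apply: env_agreeW EE'; lia.
    by apply: H'; apply: agreeW OO'; lia.
- exact: IH.
Qed.

(** * Computability and comprehension *)

Definition decides (c1 c0 : name) (E : env) (B : cantor) :=
  forall n, (holds c1 n E <-> B n) /\ (holds c0 n E <-> ~~ B n).

Definition computable (E : env) (B : cantor) := exists c1 c0, decides c1 c0 E B.

Lemma holds_use c1 c0 i c a E B :
  decides c1 c0 E B -> holds (NUse c1 c0 i c) a E <-> holds c a (update E i B).
Proof.
move=> nB; split=> /= [/(_ B) [[n [Bn]]|[n [Bn]]|//]|H B'].
- by rewrite (nB n).2 Bn.
- by rewrite (nB n).1 => Bn'; rewrite Bn' in Bn.
have [eB|/existsNP [n /eqP nBn]] := pselect (forall n, B' n = B n).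
  by constructor 3; rewrite (funext eB).
case E1: (B' n) nBn => nBn; [constructor 1|constructor 2]; exists n; rewrite E1; split=> //.
  by apply/(nB n).2; case: (B n) nBn.
by apply/(nB n).1; case: (B n) nBn.
Qed.

Lemma trunc_trunc k l E : k <= l -> trunc k (trunc l E) = trunc k E.
Proof.
move=> kl; apply: funext => i; rewrite /trunc; case: ifP => // ik.
by rewrite (leq_trans ik kl).
Qed.

(** The formulas are evaluated at W N, which carries the oracle E below position
    k and the parameters P X at the positions k + X; composition ([NUse])
    installs the parameters one by one. *)
Lemma computable_Delta01 M k N E P e n p q :
  trunc k E = E ->
  (forall X, X < N -> computable E (P X)) ->
  (forall X, free2 X p || free2 X q -> X < N) ->
  Sigma01 p -> Pi01 q ->
  (forall a, sat M (update e n a) P p <-> sat M (update e n a) P q) ->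
  computable E (fun a => `[< sat M (update e n a) P p >]).
Proof.
move=> Ek cP bN Sp Pq pq.
have /choice [g Hg] X : exists x : name * name, X < N -> decides x.1 x.2 E (P X).
  case: (ltnP X N) => [/cP [c1 [c0 H]]|_]; first by exists (c1, c0).
  by exists (NNotPath 0 0, NNotPath 0 0).
pose W m : env := fun i => if k <= i < k + m then P (i - k) else E i.
pose U := fix U m d := if m is m'.+1 then
  U m' (NUse (NTrunc k (g m').1) (NTrunc k (g m').2) (k + m') d) else d.
have HU m d a : m <= N -> holds (U m d) a E <-> holds d a (W m).
  elim: m d => [|m IH] d le.
    suff -> : W 0 = E by [].
    by apply: funext => i; rewrite /W; case: ifP => //; lia.
  rewrite [U _ _]/= IH; last exact: ltnW.
  rewrite (@holds_use _ _ _ _ _ _ (P m)).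
    suff -> : W m.+1 = update (W m) (k + m) (P m) by [].
    apply: funext => i; rewrite /update /W; case: (i =P k + m) => [->|ne].
      by rewrite ifT ?addKn //; lia.
    by congr (if _ then _ else _); lia.
  have eW : trunc k (W m) = E.
    rewrite -[RHS]Ek; apply: funext => i; rewrite /trunc; case: ifP => // ik.
    by rewrite /W ifF //; lia.
  by move=> x; rewrite /= eW; apply: Hg.
have [Np HNp] := sat_bound p; have [Nq HNq] := sat_bound q.
pose s := mkseq e (maxn Np Nq).
have es a x : x < maxn Np Nq -> update (nth 0 s) n a x = update e n a x.
  by move=> lx; rewrite /update nth_mkseq.
have WP : forall X, X < N -> W N (k + X) = P X.
  by move=> X lX; rewrite /W ifT ?addKn //; lia.
have satp a : sat M (update (nth 0 s) n a) (fun X => W N (k + X)) p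
    <-> sat M (update e n a) P p.
  rewrite (HNp _ _ (update e n a)); last by move=> x lx; apply: es; lia.
  by apply: sat_free2 => X fX; apply: WP; apply: bN; rewrite fX.
have satq a : sat M (update (nth 0 s) n a) (fun X => W N (k + X)) q
    <-> sat M (update e n a) P q.
  rewrite (HNq _ _ (update e n a)); last by move=> x lx; apply: es; lia.
  by apply: sat_free2 => X fX; apply: WP; apply: bN; rewrite fX orbT.
exists (U N (NForm k s n p)), (U N (NForm k s n (Not q))) => a.
rewrite !HU //= (forced_Sigma01 M) // (forced_Pi01 M) // satp satq; split.
  by split=> [/asboolP|/asboolP].
rewrite -pq; split=> [H|/asboolP //]; exact/asboolP.
Qed.

(** A single pair of names then works at all later stages, which only differ
    from E from position k on. *)
Lemma computable_trunc k E B : computable (trunc k E) B ->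
  exists c1 c0, forall E', trunc k E' = trunc k E -> decides c1 c0 E' B.
Proof.
move=> [c1 [c0 H]]; exists (NTrunc k c1), (NTrunc k c0) => E' eE n.
by rewrite /= eE; apply: H.
Qed.

Lemma computable_proj E i : computable E (E i).
Proof.
exists (NForm i [::] 0 (Mem (Var 0) 0)), (NForm i [::] 0 (Not (Mem (Var 0) 0))) => n.
rewrite /= /forced /= update_eq.
split; split=> [[N /(_ (fun X => E (i + X)))]|H].
- by rewrite addn0; apply.
- by exists n.+1 => E' EE'; rewrite -EE' ?addn0.
- by rewrite addn0 => H; apply/negP/H.
- by exists n.+1 => E' EE'; rewrite -EE' ?addn0 //; apply/negP.
Qed.

(** * Generic sequences *)

Lemma dependent_choice (T : Type) (Q : T -> Prop) (step : nat -> T -> T -> Prop) x0 :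
  Q x0 -> (forall n x, Q x -> exists y, Q y /\ step n x y) ->
  exists s : nat -> T, [/\ s 0 = x0, forall n, Q (s n) & forall n, step n (s n) (s n.+1)].
Proof.
move=> Q0 H.
have /choice [g Hg] (z : nat * T) : exists y, Q z.2 -> Q y /\ step z.1 z.2 y.
  by have [/(H z.1) [y Hy]|nQ] := pselect (Q z.2); [exists y|exists x0].
pose s := fix s n := if n is m.+1 then g (m, s m) else x0.
have Qs n : Q (s n) by elim: n => //= n IH; case: (Hg (n, s n) IH).
by exists s; split=> // n; case: (Hg (n, s n) (Qs n)).
Qed.

Lemma prefix_chain (s : nat -> str) m n :
  (forall i, prefix (s i) (s i.+1)) -> m <= n -> prefix (s m) (s n).
Proof.
move=> H /subnK <-; elim: (n - m) => [|i IH]; first exact: prefix_refl.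
exact: prefix_trans IH (H _).
Qed.

Lemma str_limit (s : nat -> str) :
  (forall n, prefix (s n) (s n.+1)) -> (forall n, n < size (s n.+1)) ->
  exists X, forall n, below (s n) X.
Proof.
move=> pre sz; exists (fun i => nth false (s i.+1) i) => n; apply/belowP => i lin.
have [/(prefix_chain pre)|/ltnW/(prefix_chain pre)] := leqP i.+1 n.
  by case/prefixP=> u ->; rewrite nth_cat sz.
by case/prefixP=> u ->; rewrite nth_cat lin.
Qed.

Lemma pair_code_inj i j i' j' : pair_code i j = pair_code i' j' -> i = i' /\ j = j'.
Proof.
rewrite /pair_code => e.
have s : i + j = i' + j' by move: e; rewrite !expnS !expn0 !muln1; nia.
by move: e; rewrite s; lia.
Qed.

Lemma leq_pair_code i j : i <= pair_code i j.
Proof. exact: leq_addl. Qed.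

Lemma leq_pair_coder i j : j <= pair_code i j.
Proof. by rewrite /pair_code expnS expn1; nia. Qed.

(** * A set whose inhabited columns are not computable from it *)

Definition inhabited_columns (G : cantor) : cantor :=
  fun x => `[< exists m, G (pair_code x m) >].

Definition base (G : cantor) : env := update (fun _ _ => false) 0 G.

Lemma base_agree N G G' : agree N G G' -> env_agree N (base G) (base G').
Proof. by move=> H; apply: env_agree_update. Qed.

(** In a condition (s, P), the columns listed in P are to receive no element from
    position [size s] on. *)
Definition respects (P : seq nat) (l : nat) (X : cantor) :=
  forall x m, x \in P -> l <= pair_code x m -> X (pair_code x m) = false.

Lemma fresh (P : seq nat) l : exists x, l <= x /\ x \notin P.
Proof.
exists (l + (\max_(y <- P) y).+1); split; first exact: leq_addr.
apply/negP => /(@leq_bigmax_seq nat P xpredT id)/(_ isT).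
by rewrite /= addnS ltnNge leq_addl.
Qed.

(** Take a fresh column x.  If some admissible extension t of s leaves column x
    empty and makes c0 claim that x is not in the set, put an element into column
    x after t.  Otherwise keep column x empty for ever: by openness c0 cannot make
    that claim, though it would be true. *)
Lemma base_step n (c1 c0 : name) (s : str) (P : seq nat) :
  exists t Q, [/\ prefix s t, {subset P <= Q}, respects P (size s) (nth false t), n < size t
  & forall G, below t G -> respects Q (size t) G ->
      ~ decides c1 c0 (base G) (inhabited_columns G)].
Proof.
have [x [lx xP]] := fresh P (size s).
have [[t [st rt Ht]]|no] := pselect (exists t, [/\ prefix s t,
    respects (x :: P) (size s) (nth false t)
  & forall G, below t G -> holds c0 x (base G)]).
  (* The second coordinate makes the new element come after t, and at a
     position larger than n. *)
  pose i := pair_code x (n + size t).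
  have li : n + size t <= i by apply: leq_pair_coder.
  pose t' := t ++ rcons (nseq (i - size t) false) true.
  have szt' : size t' = i.+1 by rewrite size_cat size_rcons size_nseq; lia.
  have nt' j : nth false t' j = nth false t j || (j == i).
    have ti : size t <= i by apply: leq_trans li; apply: leq_addl.
    rewrite nth_cat; case: ltnP => [lj|/(subnKC)].
      by rewrite (ltn_eqF (leq_trans lj ti)) orbF.
    move: (j - size t) => d <-; rewrite [nth false t _]nth_default ?leq_addr //=.
    rewrite nth_rcons size_nseq -(eqn_add2l (size t) d) subnKC //.
    by rewrite -(ltn_add2l (size t)) subnKC // nth_nseq if_same; case: ltngtP.
  exists t', P; split=> //.
  - by apply: prefix_trans st _; apply: prefix_prefix.
  - move=> y m yP lsy; rewrite nt' rt ?inE ?yP ?orbT //=.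
    by apply/negP => /eqP /pair_code_inj [yx _]; rewrite -yx yP in xP.
  - by rewrite szt'; lia.
  move=> G tG _ /(_ x) [_ [+ _]].
  have {}/Ht c0x : below t G by apply: below_prefix tG; apply: prefix_prefix.
  move=> /(_ c0x)/negP; apply; apply/asboolP; exists (n + size t).
  by move/belowP: tG => ->; rewrite ?szt' // nt' eqxx orbT.
pose t := s ++ nseq n.+1 false.
have szt : size t = size s + n.+1 by rewrite size_cat size_nseq.
have nt j : size s <= j -> nth false t j = false.
  by move=> lj; rewrite nth_cat ltnNge lj nth_nseq if_same.
exists t, (x :: P); split.
- exact: prefix_prefix.
- by move=> y yP; rewrite inE yP orbT.
- by move=> y m _; apply: nt.
- by rewrite szt; lia.
move=> G tG rG /(_ x) [_ [_ c0x]].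
have {}rG : respects (x :: P) (size s) G.
  move=> y m yP lsy; have [lj|lj] := ltnP (pair_code y m) (size t); last exact: rG.
  by move/belowP: tG => ->; rewrite ?nt.
have /c0x/env_open_holds [N HN] : ~~ inhabited_columns G x.
  apply/negP => /asboolP [m]; rewrite rG ?inE ?eqxx //.
  exact: leq_trans lx (leq_pair_code _ _).
apply: no; exists (restr G (maxn N (size s))); split.
- have sG : below s G by apply: below_prefix tG; apply: prefix_prefix.
  by apply: below_leq sG (below_restr _ _) _; rewrite size_restr leq_maxr.
- move=> y m yP lsy; have [lj|lj] := ltnP (pair_code y m) (maxn N (size s)).
    by rewrite nth_mkseq // rG.
  by rewrite nth_default // size_restr.
- move=> G' tG'; apply: HN; apply: base_agree; apply: agreeW (leq_maxl N (size s)) _.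
  by apply/restrP; rewrite -[in LHS]tG' size_restr.
Qed.

Theorem incomputable_columns :
  exists G, ~ computable (base G) (inhabited_columns G).
Proof.
pose step n (x y : str * seq nat) :=
  [/\ prefix x.1 y.1, {subset x.2 <= y.2}, respects x.2 (size x.1) (nth false y.1),
      n < size y.1
    & forall c1 c0, unpickle n = Some (c1, c0) ->
      forall G, below y.1 G -> respects y.2 (size y.1) G ->
      ~ decides c1 c0 (base G) (inhabited_columns G)].
have [||s [_ _ Hs]] := @dependent_choice _ (fun=> True) step ([::], [::]) => //.
  move=> n [s P] _; case E: (unpickle n : option (name * name)) => [[c1 c0]|].
    have [t [Q [H1 H2 H3 H4 H5]]] := base_step n c1 c0 s P.
    by exists (t, Q); split=> //; split=> //= d1 d0; rewrite E => -[<- <-].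
  have [t [Q [H1 H2 H3 H4 _]]] := base_step n (NNotPath 0 0) (NNotPath 0 0) s P.
  by exists (t, Q); split=> //; split=> //= d1 d0; rewrite E.
have [||G HG] := @str_limit (fun n => (s n).1).
- by move=> n; case: (Hs n).
- by move=> n; case: (Hs n).
exists G => -[c1 [c0 nG]].
have [_ _ _ _ /(_ c1 c0 (pickleK _) G)] := Hs (pickle (c1, c0)).
move: (pickle _).+1 => n; apply => // x m xP ln.
have Pm i : x \in (s (n + i)).2.
  by elim: i => [|i IH]; rewrite ?addn0 // addnS; case: (Hs (n + i)) => _ /(_ _ IH).
have Gm i : pair_code x m < size (s (n + i)).1 -> G (pair_code x m) = false.
  elim: i => [|i IH]; first by rewrite addn0 ltnNge ln.
  have [/IH //|le lt] := ltnP (pair_code x m) (size (s (n + i)).1).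
  have [_ _ r _ _] := Hs (n + i); move: lt; rewrite addnS => lt.
  by move/belowP: (HG (n + i).+1) => ->; rewrite ?r.
apply: (Gm (pair_code x m).+1); rewrite addnS.
by have [_ _ _ H _] := Hs (n + pair_code x m); apply: leq_trans H; lia.
Qed.

(** * The transformation encoded by a function on strings *)

Lemma code_inj : injective code.
Proof.
elim=> [|b s IH] [|c t] //=; rewrite -/(code _).
- by case: c; lia.
- by case: b; lia.
rewrite -/(code t) => e.
have bc : b = c by case: b c e => -[] //=; lia.
by rewrite bc; congr (_ :: _); apply: IH; rewrite bc in e; lia.
Qed.

Lemma graphP f s t : graph f (pair_code (code s) (code t)) <-> t = f s.
Proof.
split=> [/asboolP [s' /pair_code_inj [/code_inj -> /code_inj] //]|->].
by apply/asboolP; exists s.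
Qed.

Lemma below_lim_str (u : nat -> str) l :
  (forall m n, m <= n -> prefix (u m) (u n)) -> below (u l) (lim_str u).
Proof.
move=> mono; apply/belowP => i il.
have Hon m : l <= m -> onth (u m) i = Some (nth false (u l) i).
  move=> /mono /prefixP [v ->]; rewrite onth_cat il -(odflt_onth false).
  by have := onthTE (u l) i; rewrite il; case: onth.
apply/asboolP/idP => [[m Hm]|H].
  by have := Hm _ (leq_maxl m l); rewrite Hon ?leq_maxr // => -[].
by exists l => m /Hon; rewrite H.
Qed.

Lemma below_unique (u : nat -> str) X Y :
  (forall m, exists l, m <= size (u l)) ->
  (forall l, below (u l) X) -> (forall l, below (u l) Y) -> X = Y.
Proof.
move=> unb uX uY; apply: funext => i; have [l li] := unb i.+1.
by have /belowP -> // := uX l; have /belowP -> := uY l.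
Qed.

Section Transformation.

Variables (f : str -> str) (enc : encodes_transformation f).

Definition trans (Y : cantor) : cantor := transf f 1 Y.

Lemma trans_below s Y : below s Y -> below (f s) (trans Y).
Proof.
case: enc => mono _ _ sY.
have := @below_lim_str (fun l => f (restr Y l)) (size s).
by rewrite sY; apply=> m n mn; apply/mono/prefix_restr.
Qed.

Lemma trans_unbounded Y m : exists l, m <= size (f (restr Y l)).
Proof. by case: enc => _ /(_ m) [l H] _; exists l; apply: H; rewrite size_restr. Qed.

Lemma trans_unique Y Z : (forall l, below (f (restr Y l)) Z) -> Z = trans Y.
Proof.
move=> H; apply: (@below_unique (fun l => f (restr Y l))) => // [m|l].
  exact: trans_unbounded.
exact/trans_below/below_restr.
Qed.

(** Iterating f on the approximations has the same limit as iterating F: the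
    values of f^k(Y|l) are initial segments of F^k(Y), of unbounded length by
    the third clause of the encoding. *)
Lemma transfE k Y : transf f k Y = iter k trans Y.
Proof.
have [mono unb _] := enc.
have pre m n : m <= n -> prefix (iter k f (restr Y m)) (iter k f (restr Y n)).
  by move=> mn; elim: k => [|k IH]; [apply: prefix_restr | apply: mono].
have bel l : below (iter k f (restr Y l)) (iter k trans Y).
  by elim: k {pre} => [|k IH]; [apply: below_restr | apply: trans_below].
have unbk m : exists l, m <= size (iter k f (restr Y l)).
  elim: k m {pre bel} => [|k IH] m; first by exists m; rewrite size_restr.
  have [m' Hm'] := unb m; have [l Hl] := IH m'; exists l.
  have /mono/prefixP [v /= ->] : prefix (take m' (iter k f (restr Y l))) (iter k f (restr Y l)).
    exact: prefix_take.
  by rewrite size_cat; apply: leq_trans (leq_addr _ _); apply: Hm'; rewrite size_takel.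
exact: (below_unique unbk) (fun l => below_lim_str l pre) bel.
Qed.

Lemma iter_trans_cont i l : exists m, forall Y Y', agree m Y Y' ->
  agree l (iter i trans Y) (iter i trans Y').
Proof.
have [_ unb _] := enc; elim: i l => [|i IH] l; first by exists l.
have [m' Hm'] := unb l; have [m Hm] := IH m'; exists m => Y Y' /Hm /restrP e.
have le : l <= size (f (restr (iter i trans Y) m')) by apply: Hm'; rewrite size_restr.
move=> j /leq_trans/(_ le) lj.
have /trans_below/belowP bY := below_restr (iter i trans Y) m'.
have /trans_below/belowP bY' := below_restr (iter i trans Y') m'.
by rewrite /= bY // e bY' // -e.
Qed.

Lemma trans_path C Y : is_tree C -> (forall s, C (code s) -> C (code (f s))) ->
  is_path C Y -> is_path C (trans Y).
Proof.
move=> treeC fC pY m; have [l le] := trans_unbounded Y m.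
apply: treeC (fC _ (pY l)); apply: below_leq (below_restr _ _) _ _.
  exact/trans_below/below_restr.
by rewrite size_restr.
Qed.

(** * The open set of points whose orbit enters a given open set *)

Definition visit (cf : name * name) (k : nat) (u : name) : name :=
  NUse (NTrunc k cf.1) (NTrunc k cf.2) k.+1 (NVisit k k.+1 (NTrunc k.+1 u)).

Lemma trunc_update k E Y : trunc k (update E k Y) = trunc k E.
Proof.
by apply: funext => i; rewrite /trunc /update; case: ifP => // ik; rewrite ltn_eqF.
Qed.

Lemma trunc_updateS k E Y : trunc k E = E -> trunc k.+1 (update E k Y) = update E k Y.
Proof.
move=> Ek; apply: funext => i; rewrite /trunc /update ltnS leq_eqVlt.
by case: eqP => //= _; case: ltnP => // ki; rewrite -Ek /trunc ltnNge ki.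
Qed.

(** The only sequence of points that is not refuted as the orbit of Y is the true
    orbit, because a point Z with f(X|l) initial in Z for all l is F(X). *)
Lemma holds_visit cf k E u a Y : trunc k E = E -> decides cf.1 cf.2 E (graph f) ->
  holds (visit cf k u) a (update E k Y) <->
  exists i, holds u a (update E k (iter i trans Y)).
Proof.
move=> Ek nf; rewrite /visit (@holds_use _ _ _ _ _ _ (graph f)); last first.
  by move=> n; rewrite /= trunc_update Ek; apply: nf.
set E' := update (update E k Y) k.+1 (graph f).
have uE Z : trunc k.+1 (update E' k Z) = update E k Z.
  rewrite /E' updateC; last by rewrite neq_ltn ltnSn orbT.
  by rewrite update_same trunc_update trunc_updateS.
have Ef : E' k.+1 = graph f by rewrite /E' update_eq.
have EY : E' k = Y by rewrite /E' update_neq ?update_eq // neq_ltn ltnSn.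
rewrite /= Ef EY; split=> [H|[i Hi] O].
  have [O HO] := col_surj (fun i => iter i trans Y).
  case: (H O) => [[i [s [t []]]]|[m]|[i]]; rewrite !HO //=.
    by move=> /graphP -> /trans_below.
  by rewrite uE => Hi; exists i.
apply: contrapT => no.
suff HO j : col O j = iter j trans Y.
  by apply: no; constructor 3; exists i; rewrite uE HO.
elim: j => [|j /= <-].
  by apply: funext => m; apply: contrapT => H; apply: no; constructor 2; exists m.
apply: trans_unique => l; apply: contrapT => H; apply: no; constructor 1.
exists j, (restr (col O j) l), (f (restr (col O j) l)); split=> //.
  exact/graphP.
exact: below_restr.
Qed.

End Transformation.

Lemma open_holds c a E k : open (fun Y => holds c a (update E k Y)).
Proof.
move=> Y /env_open_holds [N H]; exists N => Y' YY'; apply: H; exact: env_agree_update.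
Qed.

Definition NTrue : name := NForm 0 [::] 0 (Eq Zero Zero).

Lemma holds_true a E : holds NTrue a E.
Proof. by exists 0. Qed.

(** * Almost periodic points that do not help to compute A *)

Section Forcing.

Variables (C : cantor) (f : str -> str) (k : nat) (E : env) (A : cantor).
Variables (cC cf : name * name).
Hypotheses (Ek : trunc k E = E) (treeC : is_tree C).
Hypotheses (enc : encodes_transformation f).
Hypotheses (fC : forall s, C (code s) -> C (code (f s))).
Hypotheses (nC : decides cC.1 cC.2 E C) (nf : decides cf.1 cf.2 E (graph f)).
Hypothesis ncA : ~ computable E A.

Local Notation F := (trans f).
Local Notation ext := (update E k).

Definition region (d : name) (Y : cantor) : Prop := ~ holds d 0 (ext Y).

Definition subsystem (d : name) : Prop :=
  (exists Y, region d Y) /\ (forall Y, region d Y -> region d (F Y)).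

Definition recurs (d : name) (W : cantor -> Prop) : Prop :=
  forall Y, region d Y -> exists i, W (iter i F Y).

(** Names the complement of the set of points of D whose orbit avoids the set
    named by u at x. *)
Definition remove (d u : name) (x : nat) : name :=
  NOr d (NNum x (visit cf k u)).

Lemma region_remove d u x Y : region (remove d u x) Y <->
  region d Y /\ forall i, ~ holds u x (ext (iter i F Y)).
Proof.
rewrite /region -[holds (remove _ _ _) _ _]
  /(holds d 0 (ext Y) \/ holds (visit cf k u) x (ext Y)).
have := @holds_visit f enc cf k E u x Y Ek nf.
move: (holds (visit _ _ _) _ _) => P HP; split=> [H|[H K]].
  split=> [|i Hi]; first by apply: contra_not H; left.
  by apply: H; right; apply/HP; exists i.
by case=> // /HP [i]; apply: K.
Qed.

Lemma region_iter d Y i : subsystem d -> region d Y -> region d (iter i F Y).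
Proof. by move=> [_ cl] H; elim: i => //= i; apply: cl. Qed.

(** The basic alternative of the construction: the points whose orbit avoids an
    open set form a subsystem, unless every orbit enters that set. *)
Lemma remove_dichotomy d u x : subsystem d ->
  subsystem (remove d u x) \/ recurs d (fun Y => holds u x (ext Y)).
Proof.
move=> [ne cl]; have [ne'|em] := pselect (exists Y, region (remove d u x) Y).
  left; split=> // Y /region_remove [dY H]; apply/region_remove; split; first exact: cl.
  by move=> i; rewrite -iterSr; apply: H.
right=> Y dY; apply: contrapT => H; apply: em; exists Y; apply/region_remove; split=> //.
by move=> i Hi; apply: H; exists i.
Qed.

(** By compactness the orbits in D enter the union of finitely many cylinders
    inside W.  Remove these from D one after the other: some removal would leave
    nothing, and just before it every orbit enters the cylinder at hand. *)
Lemma shrink d s W n : subsystem d -> open W ->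
  recurs d (fun Y => below s Y /\ W Y) ->
  exists d' t, [/\ subsystem d', (forall Y, region d' Y -> region d Y),
    prefix s t, n < size t & recurs d' (below t) /\ forall Y, below t Y -> W Y].
Proof.
move=> sub opW recd.
pose good t := [/\ prefix s t, n < size t & forall Y, below t Y -> W Y].
(* Strings are enumerated, so that the finitely many cylinders are those with
   a number below N. *)
pose hits N Y := exists i j t,
  [/\ j < N, unpickle j = Some t, good t & below t (iter i F Y)].
have [|||N HN] := @compactness (fun N Y => holds d 0 (ext Y) \/ hits N Y).
- move=> N Y [/open_holds [M HM]|[i [j [t [jN et gt bt]]]]].
    by exists M => Y' /HM; left.
  have [m Hm] := iter_trans_cont enc i (size t); exists m => Y' /Hm H.
  by right; exists i, j, t; split=> //; apply: below_agree bt.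
- move=> M N Y MN [|[i [j [t [jN et gt bt]]]]]; first by left.
  by right; exists i, j, t; split=> //; apply: leq_trans MN.
- move=> Y; have [dY|/contrapT] := pselect (region d Y); last by exists 0; left.
  have [i [bs /opW [M HM]]] := recd _ dY.
  pose t := restr (iter i F Y) (maxn M (maxn n.+1 (size s))).
  have szt : size t = maxn M (maxn n.+1 (size s)) by rewrite size_restr.
  exists (pickle t).+1; right; exists i, (pickle t), t; split=> //.
  + exact: pickleK.
  + split.
      apply: below_leq bs (below_restr _ _) _.
      by rewrite -/t szt !leq_max leqnn !orbT.
      by rewrite szt !leq_max leqnn !orbT.
    move=> Z bZ; apply: HM; apply: agreeW (leq_maxl M (maxn n.+1 (size s))) _.
    by apply/restrP; rewrite -/t -[in LHS]bZ szt.
  + exact: below_restr.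
have {recd} : recurs d (fun Y => exists j t,
    [/\ j < N, unpickle j = Some t, good t & below t Y]).
  by move=> Y dY; case: (HN Y) => // -[i [j [t H]]]; exists i, j, t.
elim: N d sub {HN hits} => [|N IH] d sub recd.
  by have [[Y dY] _] := sub; case: (recd _ dY) => i [j [t []]].
have [[t [et gt]]|no] := pselect (exists t, unpickle N = Some t /\ good t); last first.
  apply: IH sub _ => Y /recd [i [j [t [jN et gt bt]]]]; exists i, j, t; split=> //.
  move: jN; rewrite ltnS leq_eqVlt => /orP[/eqP eN|//].
  by case: no; exists t; rewrite -eN.
have [sub'|rect] := remove_dichotomy (NCyl t k NTrue) 0 sub.
  have [Y dY|d' [t' [H1 H2 H3 H4 H5]]] := IH _ sub'.
    have [dY' nt] := (region_remove _ _ _ _).1 dY.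
    have [i [j [t' [jN et' gt' bt']]]] := recd _ dY'; exists i, j, t'; split=> //.
    move: jN; rewrite ltnS leq_eqVlt => /orP[/eqP eN|//].
    case: (nt i) => /=; rewrite update_eq; split; last exact: holds_true.
    by move: et'; rewrite eN et => -[->].
  by exists d', t'; split=> // Y /H2 /region_remove [].
case: gt => gt1 gt2 gt3; exists d, t; split=> //; split=> // Y /rect [i] /= [].
by rewrite update_eq; exists i.
Qed.

(** Either the computation can be made to disagree with A at some x, or A is
    computed by asking which of the two open sets every orbit enters. *)
Lemma decide d s c1 c0 : subsystem d -> recurs d (below s) ->
  exists d' t, [/\ subsystem d', (forall Y, region d' Y -> region d Y),
    prefix s t, recurs d' (below t)
  & forall Y, region d' Y -> below t Y -> ~ decides c1 c0 (ext Y) A].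
Proof.
move=> sub recd; pose c b := if b then c1 else c0.
pose u b := NCyl s k (NTrunc k.+1 (c b)).
have uP b x Y : holds (u b) x (ext Y) <-> below s Y /\ holds (c b) x (ext Y).
  by rewrite /= update_eq trunc_updateS.
have [[x Hx]|no2] := pselect (exists x, subsystem (remove d (u (A x)) x)).
  exists (remove d (u (A x)) x), s; split=> //.
  - by move=> Y /region_remove [].
  - exact: prefix_refl.
  - by move=> Y /region_remove [/recd].
  move=> Y /region_remove [_ /(_ 0)] + bs /(_ x) [n1 n0]; apply; apply/uP; split=> //.
  by rewrite /c; case E1: (A x); [apply/n1 | apply/n0; rewrite E1].
have rec x : recurs d (fun Y => holds (u (A x)) x (ext Y)).
  by case: (remove_dichotomy (u (A x)) x sub) => // H; case: no2; exists x.
have [[x Hx]|no1] := pselect (exists x,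
    recurs d (fun Y => holds (u (~~ A x)) x (ext Y))).
  have [||d' [t [H1 H2 H3 _ [H4 H5]]]] :=
      @shrink d s (fun Y => holds (c (~~ A x)) x (ext Y)) 0 sub.
  - exact: open_holds.
  - by move=> Y /Hx [i /uP H]; exists i.
  exists d', t; split=> // Y dY /H5 + /(_ x) [n1 n0].
  by rewrite /c; case E1: (A x) => /=; [move=> /n0; rewrite E1 | move=> /n1; rewrite E1].
(* All orbits in D enter u (A x) at x, but not all enter u (~~ A x). *)
case: ncA; pose w b := NAll k (NOr (NNum 0 d) (visit cf k (u b))).
have wP b x : holds (w b) x E <-> recurs d (fun Y => holds (u b) x (ext Y)).
  have vP Y := @holds_visit f enc cf k E (u b) x Y Ek nf.
  rewrite -[holds _ _ _]/(forall Y, holds d 0 (ext Y) \/ holds (visit cf k (u b)) x (ext Y)).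
  split=> [H Y dY|H Y].
    by case: (H Y) => // /vP.
  have [/H ?|/contrapT] := pselect (region d Y); last by left.
  by right; apply/vP.
exists (w true), (w false) => x; rewrite !wP.
case E1: (A x); split; split=> //.
- by rewrite -E1.
- by move=> H; case: no1; exists x; rewrite E1.
- by move=> H; case: no1; exists x; rewrite E1.
- by rewrite -E1.
Qed.

(** The limit of a sequence of conditions that treats all pairs of names. *)
Theorem almost_periodic_avoiding : (exists X, is_path C X) ->
  exists X, almost_periodic C f X /\ ~ computable (ext X) A.
Proof.
move=> [X0 pX0].
pose d0 := NUse (NTrunc k cC.1) (NTrunc k cC.2) k.+1 (NNotPath k k.+1).
have d0P Y : region d0 Y <-> is_path C Y.
  rewrite /region /d0 (@holds_use _ _ _ _ _ _ C); last first.
    by move=> n; rewrite /= trunc_update Ek; apply: nC.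
  rewrite /= update_eq update_neq ?update_eq; last by rewrite neq_ltn ltnSn.
  split=> [H n|H [n]]; last by rewrite H.
  by apply/negPn/negP => Hn; apply: H; exists n.
pose Q (x : name * str) := subsystem x.1 /\ recurs x.1 (below x.2).
pose step n (x y : name * str) := [/\ (forall Y, region y.1 Y -> region x.1 Y),
  prefix x.2 y.2, n < size y.2 & forall c1 c0, unpickle n = Some (c1, c0) ->
    forall Y, region y.1 Y -> below y.2 Y -> ~ decides c1 c0 (ext Y) A].
have [||s [s0 Qs Ss]] := @dependent_choice _ Q step (d0, [::]).
- split; last by move=> Y _; exists 0.
  by split=> [|Y /d0P pY]; [exists X0; apply/d0P | apply/d0P; apply: trans_path].
- move=> n [d t] [/= sub recd].
  have [d1 [t1 [sub1 d1d tt1 rec1 H1]]] : exists d' t', [/\ subsystem d',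
      (forall Y, region d' Y -> region d Y), prefix t t', recurs d' (below t')
    & forall c1 c0, unpickle n = Some (c1, c0) ->
      forall Y, region d' Y -> below t' Y -> ~ decides c1 c0 (ext Y) A].
    case E1: (unpickle n : option (name * name)) => [[c1 c0]|].
      have [d' [t' [? ? ? ? H]]] := decide c1 c0 sub recd.
      by exists d', t'; split=> // ? ? [<- <-].
    by exists d, t; split=> //; apply: prefix_refl.
  have [||d2 [t2 [sub2 d2d t12 nt2 [rec2 _]]]] := @shrink d1 t1 (fun=> True) n sub1.
  - by move=> ? _; exists 0.
  - by move=> Y /rec1 [i]; exists i.
  exists (d2, t2); split; first by [].
  split=> //= [Y /d2d/d1d //| |c1 c0 /H1 H Y /d2d dY bt].
    exact: prefix_trans tt1 t12.
  by apply: H => //; apply: below_prefix t12 bt.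
have [||X HX] := @str_limit (fun n => (s n).2).
- by move=> n; case: (Ss n).
- by move=> n; case: (Ss n).
have mono m n Y : m <= n -> region (s n).1 Y -> region (s m).1 Y.
  move=> /subnK <-; elim: (n - m) => // i IH H; apply: IH.
  by case: (Ss (i + m)) => /(_ Y H).
have sz n : n <= size (s n).2 by case: n => // n; case: (Ss n).
have regX n : region (s n).1 X.
  move=> /open_holds [l Hl]; pose m := maxn n l.
  have [sub rec] := Qs m; have [[Y dY] _] := sub; have [i Hi] := rec _ dY.
  have := mono n m _ (leq_maxl _ _) (region_iter (i := i) sub dY); apply; apply: Hl.
  apply: agreeW (leq_trans (leq_maxr n l) (sz m)) _; apply/restrP.
  by rewrite Hi HX.
exists X; split; last first.
  move=> [c1 [c0 nX]]; have [_ _ _ /(_ c1 c0 (pickleK _) X)] := Ss (pickle (c1, c0)).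
  exact.
split; first by apply/d0P; have := regX 0; rewrite s0.
move=> c; have [sub rec] := Qs c.
have [|||b Hb] := @compactness (fun b Y => holds (s c).1 0 (ext Y) \/
    exists2 i, i < b & below (s c).2 (iter i F Y)).
- move=> N Y [/open_holds [M HM]|[i iN bi]].
    by exists M => Y' /HM; left.
  have [m Hm] := iter_trans_cont enc i (size (s c).2); exists m => Y' /Hm H.
  by right; exists i => //; apply: below_agree bi.
- move=> M N Y MN [|[i iM bi]]; first by left.
  by right; exists i => //; apply: leq_trans MN.
- move=> Y; have [/rec [i Hi]|/contrapT] := pselect (region (s c).1 Y).
    by exists i.+1; right; exists i.
  by exists 0; left.
exists b => n; case: (Hb (iter n F X)) => [H|[i ib bi]].
  by case: (region_iter (i := n) sub (regX c)); apply: H.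
exists i => //; apply/restrP; apply: agreeW (sz c) _; apply/restrP.
by rewrite HX transfE // addnC iterD bi.
Qed.

End Forcing.

(** * The model *)

Lemma decides_unique c1 c0 E B B' : decides c1 c0 E B -> decides c1 c0 E B' -> B = B'.
Proof.
move=> H H'; apply: funext => n; have [h _] := H n; have [h' _] := H' n.
by apply/idP/idP => [/h/h'|/h'/h].
Qed.

Lemma graph_inj : injective graph.
Proof. by move=> f g e; apply: funext => s; apply/graphP; rewrite -e; apply/graphP. Qed.

(** The system treated at stage n is given by a pair of pairs of names and by a
    number i; the latter only serves to treat every system at arbitrarily late
    stages, since n >= i. *)
Definition solves (n : nat) (E : env) (Y : cantor) :=
  forall (cC cf : name * name) i C f,
    n = pair_code i (pickle (cC, cf)) ->
    decides cC.1 cC.2 E C -> decides cf.1 cf.2 E (graph f) ->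
    is_tree C -> encodes_transformation f -> (exists X, is_path C X) ->
    (forall s, C (code s) -> C (code (f s))) ->
    almost_periodic C f Y.

Lemma solve n E A : trunc n.+1 E = E -> ~ computable E A ->
  exists Y, solves n E Y /\ ~ computable (update E n.+1 Y) A.
Proof.
move=> En ncA.
have [[cC [cf [i [C [f [en nC nf [tC enc pC fC]]]]]]]|no] := pselect (
  exists (cC cf : name * name) i C f, [/\ n = pair_code i (pickle (cC, cf)),
    decides cC.1 cC.2 E C, decides cf.1 cf.2 E (graph f)
  & [/\ is_tree C, encodes_transformation f, exists X, is_path C X
      & forall s, C (code s) -> C (code (f s))]]).
  have [Y [apY nY]] := almost_periodic_avoiding En tC enc fC nC nf ncA pC.
  exists Y; split=> // dC df j D g; rewrite en.
  move=> /pair_code_inj [_ /(pcan_inj pickleK) [<- <-]] nD ng _ _ _ _.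
  by rewrite -(decides_unique nC nD) -(graph_inj (decides_unique nf ng)).
(* When there is nothing to do, the update with E n.+1 changes nothing. *)
exists (E n.+1); rewrite update_id; split=> // cC cf i C f *; case: no.
by exists cC, cf, i, C, f.
Qed.

Lemma ideal_chain : exists (G : cantor) (E : nat -> env) (Y : nat -> cantor),
  [/\ E 0 = base G, forall n, E n.+1 = update (E n) n.+1 (Y n),
      forall n, solves n (E n) (Y n)
    & forall n, ~ computable (E n) (inhabited_columns G)].
Proof.
have [G ncG] := incomputable_columns; set A := inhabited_columns G in ncG *.
pose Q (x : nat * env) := trunc x.1.+1 x.2 = x.2 /\ ~ computable x.2 A.
pose step n (x y : nat * env) := y.1 = x.1.+1 /\
  (x.1 = n -> exists Y, y.2 = update x.2 n.+1 Y /\ solves n x.2 Y).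
have [||s [s0 Qs Ss]] := @dependent_choice _ Q step (0, base G).
- by split=> //; apply: trunc_updateS; apply: funext => i.
- move=> n [m E] [/= Em nA]; have [Y [sY nY]] := solve Em nA.
  exists (m.+1, update E m.+1 Y); split.
    by split=> //=; apply: trunc_updateS.
  by split=> //= <-; exists Y.
have s1 n : (s n).1 = n by elim: n => [|n IH]; rewrite ?s0 // (Ss n).1 IH.
have /choice [Y HY] n : exists Y,
    (s n.+1).2 = update (s n).2 n.+1 Y /\ solves n (s n).2 Y.
  exact: (Ss n).2.
exists G, (fun n => (s n).2), Y; split=> [|n|n|n].
- by rewrite s0.
- by case: (HY n).
- by case: (HY n).
- by case: (Qs n).
Qed.

Theorem theorem19 :
  exists M : omega_model, models M RCA0 /\ models_AP M /\ ~ models M ACA.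
Proof.
have [G [E [Y [E0 ES HY nA]]]] := ideal_chain.
have EE n : trunc n.+1 (E n) = E n.
  elim: n => [|n IH]; last by rewrite ES trunc_updateS.
  by rewrite E0; apply: trunc_updateS; apply: funext => i.
have Etr m n : m <= n -> trunc m.+1 (E n) = E m.
  move=> /subnKC <-; elim: (n - m) => [|i IH]; first by rewrite addn0.
  rewrite addnS -[RHS]IH -(@trunc_trunc _ (m + i).+1) ?ltnS ?leq_addr //.
  by rewrite ES trunc_update EE.
have uniform m B : computable (E m) B ->
    exists c : name * name, forall n, m <= n -> decides c.1 c.2 (E n) B.
  rewrite -[E m]EE => /computable_trunc [c1 [c0 H]]; exists (c1, c0) => n mn.
  by apply: H; rewrite EE Etr.
have mono m n B : m <= n -> computable (E m) B -> computable (E n) B.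
  by move=> mn /uniform [c H]; exists c.1, c.2; apply: H.
have MG : exists n, computable (E n) G.
  by exists 0; have := computable_proj (E 0) 0; rewrite {2}E0 /base update_eq.
pose M := @OmegaModel (fun B => exists n, computable (E n) B) (ex_intro _ G MG).
exists M; split; [|split].
- move=> _ [p /models_basic H|n p _|X n p q Sp Pq nX] e P MP; first exact: H.
    exact: models_induction.
  move=> pq.
  have [Np HNp] := free2_bound p; have [Nq HNq] := free2_bound q.
  have [k Hk] : exists k, forall Z, Z < maxn Np Nq -> computable (E k) (P Z).
    elim: (maxn Np Nq) => [|N [k Hk]]; first by exists 0.
    have [l Hl] := MP N; exists (maxn k l) => Z; rewrite ltnS leq_eqVlt.
    case/orP=> [/eqP ->|ZN]; first exact: mono (leq_maxr k l) Hl.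
    exact: mono (leq_maxl k l) (Hk Z ZN).
  exists (fun a => `[< sat M (update e n a) P p >]); split.
    exists k; apply: (computable_Delta01 (EE k) Hk _ Sp Pq) => // Z.
    by case/orP=> [/HNp|/HNq]; rewrite leq_max => -> //; rewrite orbT.
  move=> a; rewrite /= !update_eq.
  have -> : sat M (update e n a) (update P X (fun b => `[<sat M (update e n b) P p>])) p
      <-> sat M (update e n a) P p.
    apply: sat_free2 => Z pZ; rewrite update_neq //.
    by apply: contraTneq pZ => ->.
  by split=> /asboolP.
- move=> C f [m1 MC] [m2 Mf] [tC enc [X [_ pX]] fC].
  have [cC HC] := uniform _ _ MC; have [cf Hf] := uniform _ _ Mf.
  pose n := pair_code (maxn m1 m2) (pickle (cC, cf)).
  have mn : maxn m1 m2 <= n by apply: leq_pair_code.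
  exists (Y n); split.
    by exists n.+1; have := computable_proj (E n.+1) n.+1; rewrite {2}ES update_eq.
  apply: (HY n cC cf (maxn m1 m2)) => //.
  - by apply: HC; apply: leq_trans mn; apply: leq_maxl.
  - by apply: Hf; apply: leq_trans mn; apply: leq_maxr.
  - by exists X.
(* The formula defining A from G spells out pair_code. *)
pose sum := Add (Var 0) (Var 1).
have ar : arithmetical (Ex1 1 (Mem (Add (Mul sum sum) (Var 0)) 0)) by do 2 constructor.
move=> /(_ _ (@ACA_comprehension 1 0 _ ar isT) (fun=> 0) (fun=> G)).
case=> // B [[n cB] HB]; case: (nA n).
suff <- : B = inhabited_columns G by [].
apply: funext => a; have /= := HB a; rewrite /update /= => -[H1 H2].
have pc m : (a + m) * (a + m) + a = pair_code a m by rewrite /pair_code expnS expn1.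
apply/idP/asboolP => [/H1 [m]|[m Hm]]; rewrite ?pc; first by exists m.
by apply: H2; exists m; rewrite pc.
Qed.
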